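(* Let $n\ge 1$ and $0\le k\le n$ be integers, and let $F$ be a $k$-homogeneous $(n,m)$-function. Then $F$ is $k$th-order sum-free if and only if its complement $\overline{F}$ is $(n-k)$th-order sum-free.
   Context: An $(n,m)$-function is a map $F\colon\mathbb{F}_2^n\to\mathbb{F}_2^m$, given by its coordinate Boolean functions $f_1,\dots,f_m$, each written in algebraic normal form (ANF) as a sum of distinct monomials $x_I=\prod_{i\in I}x_i$, $I\subseteq[n]=\{1,\dots,n\}$. $F$ is $k$-homogeneous if the ANFs of all its coordinate functions contain only monomials of degree $k$. For a monomial $x_I$, its complement is $\overline{x_I}=x_{[n]\setminus I}$; for a Boolean function $f=m_1+\dots+m_t$ (sum of distinct monomials in ANF) its complement is $\overline{f}=\overline{m_1}+\dots+\overline{m_t}$; the complement $\overline{F}$ of $F$ is the $(n,m)$-function with coordinate functions $\overline{f_1},\dots,\overline{f_m}$. A $k$-flat is a set $U+a$ with $U$ a $k$-dimensional linear subspace of $\mathbb{F}_2^n$ and $a\in\mathbb{F}_2^n$. A $k$-flat $A$ is vanishing for $F$ if $\sum_{x\in A}F(x)=0$, and nonvanishing otherwise. $F$ is called $k$th-order sum-free if it has no vanishing $k$-flats. *)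

(* Defs.v *)
From HB Require Import structures.
From mathcomp Require Import all_boot all_order all_algebra.

Set Implicit Arguments.
Unset Strict Implicit.
Unset Printing Implicit Defensive.

Import GRing.Theory.
Local Open Scope ring_scope.

Definition boolfun (n : nat) : Type := 'rV['F_2]_n -> 'F_2.

Definition vecfun (n m : nat) : Type := 'rV['F_2]_n -> 'rV['F_2]_m.

Definition coordf n m (F : vecfun n m) (j : 'I_m) : boolfun n :=
  fun x => F x 0 j.

Definition monomial n (I : {set 'I_n}) : boolfun n :=
  fun x => \prod_(i in I) x 0 i.

(* A sum of distinct monomials is encoded by the set of their index sets. *)
Definition anf_eval n (S : {set {set 'I_n}}) : boolfun n :=
  fun x => \sum_(I in S) monomial I x.

(* The default set0 is never used, and the choice is forced: see anfP and
   anf_unique. *)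
Definition anf n (f : boolfun n) : {set {set 'I_n}} :=
  odflt set0 [pick S | [forall x, anf_eval S x == f x]].

Definition homogeneous n m (k : nat) (F : vecfun n m) : Prop :=
  forall (j : 'I_m) (I : {set 'I_n}), I \in anf (coordf F j) -> #|I| = k.

Definition bool_compl n (f : boolfun n) : boolfun n :=
  fun x => \sum_(I in anf f) monomial (~: I) x.

Definition compl n m (F : vecfun n m) : vecfun n m :=
  fun x => \row_j bool_compl (coordf F j) x.

Definition is_flat n (k : nat) (A : {set 'rV['F_2]_n}) : Prop :=
  exists (U : {vspace 'rV['F_2]_n}) (a : 'rV['F_2]_n),
    \dim U = k /\ A = [set u + a | u in U].

Definition vanishing n m (F : vecfun n m) (A : {set 'rV['F_2]_n}) : Prop :=
  \sum_(x in A) F x = 0.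

Definition sum_free n m (k : nat) (F : vecfun n m) : Prop :=
  forall A : {set 'rV['F_2]_n}, is_flat k A -> ~ vanishing F A.

Lemma anf_eval_inj n (S T : {set {set 'I_n}}) :
  anf_eval S =1 anf_eval T -> S = T.
Proof.
move=> eST; apply/setP => I.
have [k] := ubnP #|I|; elim: k I => // k IHk I leIk.
pose x : 'rV['F_2]_n := \row_i (i \in I)%:R.
have monE J : monomial J x = (J \subset I)%:R.
  rewrite /monomial; case: (boolP (J \subset I)) => [/subsetP sJI|].
    by rewrite big1 // => i /sJI iI; rewrite mxE iI.
  case/subsetPn => i iJ iI.
  by rewrite (bigD1 i) //= mxE (negPf iI) mul0r.
have evE (V : {set {set 'I_n}}) : anf_eval V x =
    (I \in V)%:R + \sum_(J : {set 'I_n} | J \proper I) (J \in V)%:R.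
  rewrite /anf_eval big_mkcond (bigD1 I) //= monE subxx; congr (_ + _).
    by case: (I \in V).
  rewrite [RHS]big_mkcond [LHS]big_mkcond; apply: eq_bigr => J _.
  by rewrite monE properEneq; case: (J \in V); case: (J != I); case: (J \subset I).
have := eST x; rewrite !evE.
rewrite (eq_bigr (fun J => (J \in T)%:R : 'F_2)).
  by move/addIr; case: (I \in S); case: (I \in T).
move=> J /proper_card ltJI; rewrite IHk //; exact: leq_trans ltJI leIk.
Qed.

Lemma anfP n (f : boolfun n) : anf_eval (anf f) =1 f.
Proof.
pose ev (S : {set {set 'I_n}}) : {ffun 'rV['F_2]_n -> 'F_2} :=
  [ffun x => anf_eval S x].
have ev_inj : injective ev.
  by move=> S T /ffunP eST; apply: anf_eval_inj => x; have := eST x; rewrite !ffunE.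
have [|g _ evK] := inj_card_bij ev_inj.
  rewrite card_ffun card_mx card_Fp // mul1n.
  by rewrite -!cardsT -!powersetT !card_powerset !cardsT card_ord.
rewrite /anf; case: pickP => [S /forallP eS x|/(_ (g [ffun x => f x]))].
  exact/eqP.
case/forallP => x; have /ffunP/(_ x) := evK [ffun x => f x].
by rewrite !ffunE => ->.
Qed.

Lemma anf_unique n (f : boolfun n) (S : {set {set 'I_n}}) :
  anf_eval S =1 f -> S = anf f.
Proof. by move=> eS; apply: anf_eval_inj => x; rewrite eS anfP. Qed.

(* Main.v *)
Require Import Defs.
From mathcomp Require Import all_boot all_order all_algebra.

(** For [#|I| = \dim U], the sum of the monomial [x_I] over a flat [U + a] is 1
if the projection of [U] onto the coordinates in [I] is injective, and 0
otherwise: in the first case the projection is bijective and exactly one point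
of the flat has all its [I]-coordinates equal to 1; in the second case
translation by a nonzero element of the kernel pairs off the points of the flat.
The projection of [U] onto [I] is injective exactly when the projection of the
orthogonal of [U] onto the complement of [I] is, so [F] on a flat directed by
[U] and its complement on any flat directed by the orthogonal of [U] have the
same sum. *)

Set Implicit Arguments.
Unset Strict Implicit.
Unset Printing Implicit Defensive.

Import GRing.Theory.
Local Open Scope ring_scope.

Section Orthogonal.
Variables (K : fieldType) (n : nat).
Implicit Types (U : {vspace 'rV[K]_n}) (I : {set 'I_n}) (u v : 'rV[K]_n).

Lemma dim_fullrV d : \dim {:'rV[K]_d} = d.
Proof. by rewrite dimvf /dim /= mul1n. Qed.

Definition dotp u v : K := \sum_i u 0 i * v 0 i.

Lemma dotpC u v : dotp u v = dotp v u.
Proof. by apply: eq_bigr => i _; rewrite mulrC. Qed.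

Definition vbasis_mx U : 'M[K]_(\dim U, n) := \matrix_(i, j) (vbasis U)`_i 0 j.

(** The orthogonal of [U] for [dotp], as the kernel of the map pairing a vector with a basis of [U];
    rank-nullity then gives its dimension. *)
Definition orthov U : {vspace 'rV[K]_n} :=
  lker (linfun (mulmxr (vbasis_mx U)^T : 'rV_n -> 'rV_(\dim U))).

Lemma mulmx_vbasis_mx U (c : 'rV_(\dim U)) :
  c *m vbasis_mx U = \sum_i c 0 i *: (vbasis U)`_i.
Proof.
apply/rowP => j; rewrite !mxE summxE.
by apply: eq_bigr => i _; rewrite !mxE.
Qed.

Lemma row_free_vbasis_mx U : row_free (vbasis_mx U).
Proof.
apply: inj_row_free => c; rewrite mulmx_vbasis_mx => c0.
apply/rowP => i; rewrite mxE.
by move/freeP: (basis_free (vbasisP U)); apply.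
Qed.

Lemma dim_orthov U : (\dim (orthov U) = n - \dim U)%N.
Proof.
set f := linfun (mulmxr (vbasis_mx U)^T : 'rV_n -> 'rV_(\dim U)).
have limgf : limg f = fullv.
  apply/vspaceP => y; rewrite memvf.
  (* A right inverse [C] of the basis matrix yields the preimage [y *m C^T] of [y], so the pairing
     map is onto. *)
  have /row_freeP[C BC] := row_free_vbasis_mx U.
  have -> : y = f (y *m C^T).
    by rewrite lfunE /= -mulmxA -trmx_mul BC trmx1 mulmx1.
  by rewrite memv_img ?memvf.
have := limg_ker_dim f fullv.
by rewrite capfv limgf !dim_fullrV -/(orthov U) => /(canRL (addnK _)).
Qed.

Lemma orthovP U v :
  reflect (forall u, u \in U -> dotp v u = 0) (v \in orthov U).
Proof.
have dotpE i : (v *m (vbasis_mx U)^T) 0 i = dotp v (vbasis U)`_i.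
  by rewrite mxE; apply: eq_bigr => j _; rewrite !mxE.
rewrite memv_ker lfunE /=; apply: (iffP eqP) => [v0 u uU | v0].
  rewrite (coord_vbasis uU) /dotp.
  under eq_bigr do rewrite summxE mulr_sumr.
  rewrite exchange_big big1 //= => i _.
  under eq_bigr do rewrite mxE mulrCA.
  by rewrite -mulr_sumr -/(dotp _ _) -dotpE v0 mxE mulr0.
apply/rowP => i; rewrite dotpE mxE v0 //.
by rewrite vbasis_mem // mem_nth // size_tuple.
Qed.

(** One inclusion is the symmetry of [dotp], and the dimensions agree. This holds even when [U]
    meets its orthogonal nontrivially, as can happen over ['F_2]. *)
Lemma orthovK U : orthov (orthov U) = U.
Proof.
apply/esym/eqP; rewrite eqEdim !dim_orthov; apply/andP; split.
  apply/subvP => u uU; apply/orthovP => v /orthovP vU.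
  by rewrite dotpC vU.
have := dimvS (subvf U); rewrite dim_fullrV => leUn.
by rewrite subKn.
Qed.

Definition coord_proj I : 'Hom('rV[K]_n, 'rV[K]_#|I|) :=
  linfun (colsub (enum_val : 'I_#|I| -> 'I_n)).

Lemma coord_projP I u v :
  coord_proj I u = coord_proj I v <-> {in I, forall i, u 0 i = v 0 i}.
Proof.
rewrite !lfunE; split => [/rowP uv i iI | uv].
  by have := uv (enum_rank_in iI i); rewrite !mxE enum_rankK_in.
by apply/rowP => j; rewrite !mxE uv // enum_valP.
Qed.

Definition proj_inj U I := (U :&: lker (coord_proj I) == 0)%VS.

Lemma proj_injP U I :
  reflect (forall u, u \in U -> {in I, forall i, u 0 i = 0} -> u = 0)
          (proj_inj U I).
Proof.
have kerP u : u \in lker (coord_proj I) <-> {in I, forall i, u 0 i = 0}.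
  rewrite memv_ker -(linear0 (coord_proj I)); split.
    by move/eqP/coord_projP => u0 i /u0 ->; rewrite mxE.
  by move=> u0; apply/eqP/coord_projP => i /u0 ->; rewrite mxE.
rewrite /proj_inj -subv0; apply: (iffP subvP) => UI u.
  move=> uU u0; apply/eqP; rewrite -memv0; apply: UI.
  by rewrite memv_cap uU; apply/kerP.
by rewrite memv_cap memv0 => /andP[uU /kerP u0]; apply/eqP/UI.
Qed.

(** An injective linear map between spaces of equal dimension is onto. *)
Lemma proj_inj_surj U I v : #|I| = \dim U -> proj_inj U I ->
  exists2 u, u \in U & {in I, forall i, u 0 i = v 0 i}.
Proof.
move=> dimU /eqP UI.
have imU : (coord_proj I @: U = fullv)%VS.
  apply/eqP; rewrite eqEdim subvf /= limg_dim_eq //.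
  by rewrite dim_fullrV dimU.
have : coord_proj I v \in (coord_proj I @: U)%VS by rewrite imU memvf.
by case/memv_imgP => u uU /esym /coord_projP uv; exists u.
Qed.

(** Let [w] be orthogonal to [U] and supported in [I]. For [i] in [I], some [u] in [U] agrees on [I]
    with the [i]-th unit vector, so [dotp w u] is the [i]-th coordinate of [w], which must be 0. *)
Lemma proj_inj_orthov_imp U I : #|I| = \dim U ->
  proj_inj U I -> proj_inj (orthov U) (~: I).
Proof.
move=> dimU UI; apply/proj_injP => w /orthovP wU w0.
apply/rowP => i; rewrite [RHS]mxE.
have [iI|iNI] := boolP (i \in I); last by rewrite w0 // inE.
have [u uU uE] := proj_inj_surj (delta_mx 0 i) dimU UI.
rewrite -(wU u uU) /dotp (bigD1 i) //= uE // mxE !eqxx mulr1 big1 ?addr0 //.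
move=> j ji; have [jI|jNI] := boolP (j \in I); last by rewrite w0 ?mul0r // inE.
by rewrite uE // mxE (negPf ji) mulr0.
Qed.

Lemma proj_inj_orthov U I : #|I| = \dim U ->
  proj_inj (orthov U) (~: I) = proj_inj U I.
Proof.
move=> dimU; apply/idP/idP; last exact: proj_inj_orthov_imp.
have dimU' : #|~: I| = \dim (orthov U).
  by rewrite dim_orthov -dimU cardsCs setCK card_ord.
by move/(proj_inj_orthov_imp dimU'); rewrite orthovK setCK.
Qed.

End Orthogonal.

Section FlatSums.
Variable n : nat.
Implicit Types (U : {vspace 'rV['F_2]_n}) (I : {set 'I_n}) (a x : 'rV['F_2]_n).

Lemma F2_neq0 (c : 'F_2) : c != 0 -> c = 1.
Proof. by case: c => [[|[|[]]]] // i _; apply/val_inj. Qed.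

Lemma F2_addrr (c : 'F_2) : c + c = 0.
Proof. exact/(addrr_pchar2 (pchar_Fp _)). Qed.

Definition flat U a : {set 'rV['F_2]_n} := [set u + a | u in U].

Lemma mem_flat U a x : (x \in flat U a) = (x - a \in U).
Proof.
apply/imsetP/idP => [[u uU ->]|xU]; first by rewrite addrK.
by exists (x - a); rewrite ?subrK.
Qed.

Lemma monomial_eq1 I x : {in I, forall i, x 0 i = 1} -> monomial I x = 1.
Proof. by move=> x1; rewrite /monomial big1. Qed.

Lemma monomial_eq0 I x i : i \in I -> x 0 i != 1 -> monomial I x = 0.
Proof.
move=> iI xi; rewrite /monomial (bigD1 i) //=.
by have [->|/F2_neq0 xi1] := eqVneq (x 0 i) 0; rewrite ?mul0r // xi1 in xi *.
Qed.

Lemma flat_sum_proj_inj U a I : #|I| = \dim U -> proj_inj U I ->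
  \sum_(x in flat U a) monomial I x = 1.
Proof.
move=> dimU UI.
(* The target is chosen so that [u + a] has all its [I]-coordinates equal to 1. *)
have [u uU uE] := proj_inj_surj (const_mx 1 - a) dimU UI.
have x1 : {in I, forall i, (u + a) 0 i = 1}.
  by move=> i iI; rewrite mxE uE // !mxE subrK.
rewrite (bigD1 (u + a)) /= ?mem_flat ?addrK //.
rewrite monomial_eq1 // big1 ?addr0 // => y /andP[yA yx].
have [/forall_inP y1|] := boolP [forall i in I, y 0 i == 1]; last first.
  by rewrite negb_forall_in => /exists_inP[i iI]; apply: monomial_eq0.
(* Here [y] and [u + a] agree on [I], so their difference lies in [U] and projects to 0. *)
case/eqP: yx; apply/eqP; rewrite -subr_eq0; apply/eqP.
apply: (proj_injP _ _ UI) => [|i iI].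
  by rewrite opprD addrA addrAC memvB // -mem_flat.
by rewrite 2!mxE x1 // (eqP (y1 i iI)) subrr.
Qed.

Lemma flat_sum_proj_Ninj U a I : ~~ proj_inj U I ->
  \sum_(x in flat U a) monomial I x = 0.
Proof.
rewrite /proj_inj -vpick0; set t := vpick _ => t0.
have : t \in (U :&: lker (coord_proj _ I))%VS by exact: memv_pick.
rewrite memv_cap memv_ker -(linear0 (coord_proj _ I)).
case/andP=> tU /eqP/coord_projP tI.
have [i ti] : exists i, t 0 i != 0.
  apply/existsP; rewrite -negb_forall; apply: contra t0 => /forallP tz.
  by apply/eqP/rowP => i; rewrite (eqP (tz i)) mxE.
(* Translation by [t] flips coordinate [i] and fixes those in [I]: it exchanges the two halves of
   the flat and preserves the monomial, so the half sums are equal and cancel. *)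
rewrite (bigID (fun x : 'rV_n => x 0 i == 0)) /=.
rewrite (reindex_inj (addIr t)) /= (eq_bigl (fun x => (x \in flat U a) && (x 0 i != 0))).
  rewrite (eq_bigr (monomial I)) ?F2_addrr // => x _.
  by apply: eq_bigr => j /tI; rewrite !mxE => ->; rewrite addr0.
move=> x; rewrite !mem_flat addrAC rpredDr // mxE (F2_neq0 ti).
by case: (x 0 i) => [[|[|[]]]].
Qed.

Lemma flat_sum_monomial U a I : #|I| = \dim U ->
  \sum_(x in flat U a) monomial I x = (proj_inj U I)%:R.
Proof.
by case: (boolP (proj_inj U I)) => UI dimU;
   [rewrite flat_sum_proj_inj | rewrite flat_sum_proj_Ninj].
Qed.

(** Both sums range over the same index sets [I], all of size [k], and their terms agree by
    [proj_inj_orthov]. The base points [a] and [b] are independent. *)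
Lemma flat_sum_compl m k (F : vecfun n m) U a b :
  homogeneous k F -> \dim U = k ->
  \sum_(x in flat (orthov U) b) compl F x = \sum_(x in flat U a) F x.
Proof.
move=> hF dimU; apply/rowP => j; rewrite !summxE.
under eq_bigr do rewrite mxE.
under [RHS]eq_bigr do rewrite -/(coordf F j _) -anfP.
rewrite exchange_big [RHS]exchange_big /=; apply: eq_bigr => I /hF cardI.
have dimI : #|I| = \dim U by rewrite cardI.
rewrite !flat_sum_monomial ?proj_inj_orthov //.
by rewrite dim_orthov -dimI cardsCs setCK card_ord.
Qed.

End FlatSums.

Theorem theorem5p15 (n m k : nat) (hn : (0 < n)%N) (hk : (k <= n)%N)
    (F : vecfun n m) (hF : homogeneous k F) :
  sum_free k F <-> sum_free (n - k) (compl F).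
Proof.
split=> sfF A [U [a [dimU ->]]].
  have dimW : \dim (orthov U) = k by rewrite dim_orthov dimU subKn.
  (* [U] is written as the orthogonal of [orthov U], which has dimension [k]; the base point 0 is an
     arbitrary choice. *)
  rewrite /vanishing -/(flat U a) -{1}(orthovK U) (flat_sum_compl 0 a hF dimW).
  by apply: sfF; exists (orthov U), 0.
rewrite /vanishing -/(flat U a) -(flat_sum_compl a 0 hF dimU).
by apply: sfF; exists (orthov U), 0; rewrite dim_orthov dimU.
Qed.
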